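(* Let $H$ be a multigraph with two given distinct vertices $a$ and $b$. Suppose that $H$ contains three internally disjoint $(a,b)$-paths. Then for every $(a,b)$-path $P$ in $H$, there is a cycle $C$ in $H$ passing through $a$ and $b$ such that $|E(C)\cap E(P)|\geq |P|/6$.
   Context: Here a multigraph is a finite graph that may contain parallel edges and loops; a pair of parallel edges is treated as a cycle of length two and a loop as a cycle of length one. An $(a,b)$-path is a path with endpoints $a$ and $b$. The length $|P|$ of a path $P$ is its number of edges. Paths in a multigraph are considered together with their edges, so that two different parallel edges joining $a$ and $b$ give two different $(a,b)$-paths. Two (different) $(a,b)$-paths are internally disjoint if their only common vertices are $a$ and $b$; ''three internally disjoint paths'' means three distinct, pairwise internally disjoint paths. *)

(* Defs.v *)
From mathcomp Require Import all_boot all_order all_algebra.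

Set Implicit Arguments.
Unset Strict Implicit.
Unset Printing Implicit Defensive.

(* Edges form a type of their own, so parallel edges are distinct edges with
   the same set of ends; a loop is an edge whose set of ends is a singleton. *)
Record multigraph := Multigraph {
  vertex : finType;
  edge : finType;
  ends : edge -> {set vertex};
  ends_card : forall e, 0 < #|ends e| <= 2
}.

Section Walks.

Variable H : multigraph.
Implicit Types (x y a b : vertex H) (e : edge H) (p q c : seq (edge H * vertex H)).

Definition joins e x y : bool := ends e == [set x; y].

(* A walk x, e1, v1, ..., ek, vk is encoded by its initial vertex x and the
   sequence (e1, v1), ..., (ek, vk) of its steps; its length k is the size of
   that sequence. *)
Fixpoint is_walk x p y : bool :=
  if p is (e, z) :: p' then joins e x z && is_walk z p' y else x == y.

Definition edge_set p : {set edge H} := [set e in [seq s.1 | s <- p]].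

Definition vertex_set x p : {set vertex H} := [set v in x :: [seq s.2 | s <- p]].

Definition is_path a b p : bool :=
  is_walk a p b && uniq (a :: [seq s.2 | s <- p]).

(* Comparing step sequences is the same as comparing paths as subgraphs,
   since an (a,b)-path, seen as a subgraph, has a single traversal from a to b. *)
Definition internally_disjoint a b p q : bool :=
  (p != q) && (vertex_set a p :&: vertex_set a q == [set a; b]).

(* Distinctness of the edges matters only in length two, where it excludes
   traversing the same edge back and forth. *)
Definition is_cycle x c : bool :=
  [&& is_walk x c x, 0 < size c,
      uniq [seq s.2 | s <- c] & uniq [seq s.1 | s <- c]].

End Walks.

(* Main.v *)
Require Import Defs.
From mathcomp Require Import all_boot all_order all_algebra.
From mathcomp Require Import perm.
From mathcomp Require Import zify.
From Stdlib Require Import Classical.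

(* Choose three internally disjoint (a,b)-paths Q_l using as few edges outside P
   as possible, and cut P at its vertices on the Q_l.  Each piece is an edge of
   some Q_l or a jump, avoiding the Q_l internally; the jumps taken among every
   other piece are pairwise vertex-disjoint, so the jumps split into two such
   classes.

   Fix a class.  By minimality the jumps of the class are consistently ordered
   along the Q_l: scanning the Q_l from a, there is always a jump joining the
   first jump ends on two different Q_l, since otherwise the jumps leaving the
   first jump ends contain a cyclic pattern Q_i -> Q_j -> ... -> Q_i, and
   rerouting the Q_l along it saves an edge outside P.

   Sweep in that order with two paths occupying two of the three Q_l, the third
   being the hole.  When a jump has an end on the hole, the path at its other
   end takes the jump, and the hole moves.  The three possible initial holes
   give three cycles through a and b which together use every edge of the Q_l
   and every jump of the class.  Both classes give six cycles covering P. *)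

Set Implicit Arguments.
Unset Strict Implicit.
Unset Printing Implicit Defensive.

(** * Walks as multisets of edges and vertices *)

Section Items.

Variable H : multigraph.
Implicit Types (x y u v : vertex H) (e : edge H).
Implicit Types (p q w : seq (edge H * vertex H)).

(* Edges and vertices in one multiset: path-ness and disjointness then become
   upper bounds on occurrence counts, which are additive under concatenation. *)
Fixpoint items p : seq (edge H + vertex H) :=
  if p is s :: p' then [:: inl s.1, inr s.2 & items p'] else [::].

Lemma items_cat p q : items (p ++ q) = items p ++ items q.
Proof. by elim: p => //= s p ->. Qed.

Lemma mem_items_edge e p : (inl e \in items p) = (e \in [seq s.1 | s <- p]).
Proof. by elim: p => //= -[e' v] p IHp; rewrite !in_cons IHp. Qed.

Lemma mem_items_vertex v p : (inr v \in items p) = (v \in [seq s.2 | s <- p]).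
Proof. by elim: p => //= -[e' u] p IHp; rewrite !in_cons IHp. Qed.

Lemma items_uniq p :
  uniq (items p) = uniq [seq s.1 | s <- p] && uniq [seq s.2 | s <- p].
Proof.
elim: p => //= -[e v] p IHp; rewrite /= !in_cons /= mem_items_edge mem_items_vertex IHp.
by case: (e \in _); case: (v \in _); rewrite ?andbF.
Qed.

Lemma walk_cat x y z p q :
  is_walk x p y -> is_walk y q z -> is_walk x (p ++ q) z.
Proof.
elim: p x => [x /eqP -> //|[e v] p IHp x] /= /andP[-> xp] yq.
exact: IHp.
Qed.

Lemma walk_catE x z p q : is_walk x (p ++ q) z ->
  exists2 y, is_walk x p y & is_walk y q z.
Proof.
elim: p x => [x xq|[e v] p IHp x] /=; first by exists x.
by case/andP=> -> /IHp[y ? ?]; exists y.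
Qed.

Lemma walk_end x y z p : is_walk x p y -> is_walk x p z -> y = z.
Proof.
elim: p x => [x /eqP <- /eqP //|[e v] p IHp x] /=.
by case/andP=> _ xy /andP[_]; apply: IHp.
Qed.

Lemma walk_items_rcons x y p : is_walk x p y -> p != [::] ->
  exists n, items p = rcons n (inr y).
Proof.
elim: p x => [//|[e v] [|s p] IHp] x.
  by rewrite /= => /andP[_ /eqP->] _; exists [:: inl e].
case/andP=> _ /IHp[] // n en _; exists [:: inl e, inr v & n].
by rewrite -cat1s items_cat en.
Qed.

Lemma walk_end_mem x y p : is_walk x p y -> x != y -> inr y \in items p.
Proof.
move=> xp xy; have pN : p != [::] by case: p xp => [/eqP e|//]; rewrite e eqxx in xy.
by have [n ->] := walk_items_rcons xp pN; rewrite mem_rcons mem_head.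
Qed.

Lemma walk_split x y v p : is_walk x p y -> inr v \in items p ->
  exists q r, [/\ p = q ++ r, is_walk x q v, is_walk v r y & inr v \in items q].
Proof.
elim: p x => [//|[e u] p IHp] x /= /andP[exu up]; rewrite !in_cons /=.
case: (eqVneq v u) => [uv|vu] /=.
  subst u; exists [:: (e, v)], p; split => //; first by rewrite /= exu eqxx.
  by rewrite !in_cons eqxx orbT.
rewrite (inj_eq (@inr_inj _ _)) (negPf vu) /= => /(IHp _ up)[q [r [-> uq vr vq]]].
exists ((e, u) :: q), r; split=> //=; first by rewrite exu.
by rewrite !in_cons vq !orbT.
Qed.

(** The initial vertex does not count as a visit, so a walk that starts in [D] is cut at its next
    vertex of [D]. *)
Lemma walk_first (D : {set vertex H}) x y p : is_walk x p y ->
    (exists2 u, u \in D & inr u \in items p) ->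
  exists q r u, [/\ p = q ++ r, is_walk x q u, is_walk u r y, u \in D & inr u \in items q]
    /\ {in D, forall v, inr v \in items q -> v = u}.
Proof.
elim: p x => [x _ [u _]|[e z] p IHp x] //= /andP[exz zp] hD.
case: (boolP (z \in D)) => zD.
  exists [:: (e, z)], p, z; split; last first.
    by move=> v _; rewrite !in_cons /= orbF => /eqP[].
  by split; rewrite //= ?exz ?eqxx // !in_cons eqxx orbT.
have [|q [r [u [[-> zq ur uD uq] first_u]]]] := IHp _ zp.
  case: hD => u uD; rewrite !in_cons /= => /orP[/eqP[uz]|up]; last by exists u.
  by rewrite -uz uD in zD.
exists ((e, z) :: q), r, u; split; first by split; rewrite //= ?exz // !in_cons uq !orbT.
move=> v vD; rewrite !in_cons /= => /orP[/eqP[vz]|]; last exact: first_u.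
by rewrite -vz vD in zD.
Qed.

Lemma edge_split e p : inl e \in items p -> exists q v r, p = q ++ (e, v) :: r.
Proof.
elim: p => [//|[e' v] p IHp]; rewrite !in_cons /= => /orP[/eqP[->]|].
  by exists [::], v, p.
by case/IHp => q [u [r ->]]; exists ((e', v) :: q), u, r.
Qed.

Lemma walk_end_in x y p : is_walk x p y -> y \in x :: [seq s.2 | s <- p].
Proof.
elim: p x => [x /eqP->|[e z] p IHp x] /=; first by rewrite mem_head.
by case/andP=> _ /IHp yp; rewrite in_cons yp orbT.
Qed.

Lemma walk_edge_end x y e u v p : is_walk x p y -> inl e \in items p ->
  joins e u v -> u \in x :: [seq s.2 | s <- p].
Proof.
move=> xp /edge_split[q [z [r ep]]]; move: xp; rewrite ep => /walk_catE[t xq].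
case/andP=> /eqP et _ /eqP eu.
have : u \in ends e by rewrite eu in_set2 eqxx.
rewrite et in_set2 map_cat -cat_cons mem_cat => /orP[]/eqP->.
  by rewrite (walk_end_in xq).
by rewrite /= !in_cons eqxx !orbT.
Qed.

(** A repetition of the first edge would put the initial vertex on the walk again, so distinct
    vertices already force distinct edges. *)
Lemma path_items_uniq x y p : is_walk x p y ->
  uniq (x :: [seq s.2 | s <- p]) -> uniq (items p).
Proof.
elim: p x => //= -[e z] p IHp x /andP[exz zp] /andP[xp up] /=.
rewrite in_cons /= mem_items_vertex (IHp z) //= andbT.
move: (up) => /= /andP[-> _]; rewrite andbT.
by apply: contra xp => ep; apply: walk_edge_end zp ep exz.
Qed.

Lemma joinsC e x y : joins e x y = joins e y x.
Proof. by rewrite /joins setUC. Qed.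

(** [items] omits the initial vertex, so reversal trades [y] for [x]; restoring it on both sides
    makes the two multisets equal. *)
Lemma walk_rev x y p : is_walk x p y ->
  exists2 q, is_walk y q x & perm_eq (inr x :: items p) (inr y :: items q).
Proof.
elim: p x => [x /eqP->|[e v] p IHp x] /=; first by exists [::] => /=.
case/andP=> exv /IHp[q vq pq]; exists (q ++ [:: (e, x)]).
  by apply: walk_cat vq _; rewrite /= joinsC exv eqxx.
apply/seq.permP => a; move/seq.permP/(_ a): pq => /=.
rewrite items_cat count_cat /=; lia.
Qed.

(** * Occurrence counts *)

Implicit Types (t : edge H + vertex H) (n m : seq (edge H + vertex H)).

Definition occ t n : nat := count_mem t n.

Lemma occ_cat t n m : occ t (n ++ m) = occ t n + occ t m.
Proof. exact: count_cat. Qed.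

Lemma occ_cons t t' n : occ t (t' :: n) = occ t [:: t'] + occ t n.
Proof. exact: (occ_cat t [:: t'] n). Qed.

Lemma occ_rcons t t' n : occ t (rcons n t') = occ t n + occ t [:: t'].
Proof. by rewrite -cats1 occ_cat. Qed.

Lemma occ_gt0 t n : (0 < occ t n) = (t \in n).
Proof. by rewrite -has_count has_pred1. Qed.

Lemma occ_vertex_gt0 v n : inr v \in n -> 0 < occ (inr v) n.
Proof. by rewrite occ_gt0. Qed.

Lemma occ_eq0 t n : t \notin n -> occ t n = 0.
Proof. by move/count_memPn. Qed.

Lemma occ1 t t' : occ t [:: t'] = (t == t').
Proof. by rewrite /occ /= addn0 eq_sym. Qed.

Lemma occ1_vertex u v : occ (inr u) [:: inr v] = (u == v).
Proof. by rewrite occ1. Qed.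

Lemma occ1_le t t' n : t' \in n -> occ t [:: t'] <= occ t n.
Proof. by rewrite occ1 -occ_gt0; case: eqP => // ->. Qed.

Lemma notin_occ t n : occ t n = 0 -> t \notin n.
Proof. by move/count_memPn. Qed.

Lemma occ_perm t n m : perm_eq n m -> occ t n = occ t m.
Proof. by move/seq.permP; apply. Qed.

Lemma perm_occ n m : (forall t, occ t n = occ t m) -> perm_eq n m.
Proof. by move=> h; apply/allP => t _; apply/eqP; apply: h. Qed.

Lemma uniq_occ n : (forall t, occ t n <= 1) -> uniq n.
Proof.
move=> h; apply: count_mem_uniq => t; have := h t; rewrite -occ_gt0 /occ.
by case: count => [|[|]].
Qed.

Lemma occ_uniq t n : uniq n -> occ t n <= 1.
Proof. by move=> un; rewrite /occ count_uniq_mem // leq_b1. Qed.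

Lemma occ_cat_items t p q : occ t (items (p ++ q)) = occ t (items p) + occ t (items q).
Proof. by rewrite items_cat occ_cat. Qed.

Lemma notin_left t n m : occ t n + occ t m <= 1 -> t \in m -> t \notin n.
Proof. by rewrite -occ_gt0 => ? ?; apply: notin_occ; lia. Qed.

End Items.

Arguments occ : simpl never.

(** * Cyclic exchanges *)

Section Exchange.

Variables (H : multigraph) (b : vertex H) (F : {set edge H}) (I : finType).
Implicit Types (x y u v : vertex H) (e : edge H).
Implicit Types (p q w : seq (edge H * vertex H)).

Definition cost p := count (fun e => e \notin F) [seq s.1 | s <- p].

Lemma cost_cat p q : cost (p ++ q) = cost p + cost q.
Proof. by rewrite /cost map_cat count_cat. Qed.

Lemma cost_eq0 p : cost p = 0 -> {subset [seq s.1 | s <- p] <= F}.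
Proof.
move=> /eqP; rewrite -leqn0 leqNgt -has_count => /hasPn h e /h.
by rewrite negbK.
Qed.

(* When [F] is the edge set of a path containing [e], the two sides of [e] on
   the path are such an [s]. *)
Definition separates e x y : Prop := exists2 s : vertex H -> bool, s x != s y &
  forall e' u v, e' \in F -> e' != e -> joins e' u v -> s u = s v.

Lemma walk_same_side e (s : vertex H -> bool) x y p :
  (forall e' u v, e' \in F -> e' != e -> joins e' u v -> s u = s v) ->
  is_walk x p y -> cost p = 0 -> inl e \notin items p -> s x = s y.
Proof.
move=> se xp /cost_eq0 pF; rewrite mem_items_edge.
elim: p x xp pF => [x /eqP->//|[e' v] p IHp x] /= /andP[exv vp] pF.
rewrite in_cons negb_or => /andP[ee' ep].
rewrite (se _ _ _ (pF e' _) _ exv) ?mem_head 1?eq_sym //.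
by apply: IHp => // e'' e''p; apply: pF; rewrite in_cons e''p orbT.
Qed.

(* Replace [p l = A l ++ B l] by [A l ++ W l ++ C l], for l in [O]; this drops the
   segments [M l].  If all [M l] cost nothing, then the [M l] and the [W l] form
   a closed walk in [F] using a separating edge [e] only once. *)
Lemma exchange (x : I -> vertex H) (p A B W M C : I -> seq (edge H * vertex H))
    (O : {set I}) (f : I -> I) (y z : I -> vertex H)
    (inn : I -> seq (edge H + vertex H)) :
  (forall l, is_walk (x l) (p l) b) ->
  (forall l, occ (inr b) (items (p l)) <= 1) ->
  {in O &, injective f} -> f @: O = O ->
  {in O, forall l, [/\ p l = A l ++ B l, B (f l) = M l ++ C l,
     items (W l) = rcons (inn l) (inr (z l)) & inr (z l) \in items (M l)]} ->
  {in O, forall l, [/\ is_walk (x l) (A l) (y l), is_walk (y l) (W l) (z l),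
     is_walk (y (f l)) (M l) (z l) & is_walk (z l) (C l) b]} ->
  {in O, forall l, [/\ inr b \notin items (A l), inr b \notin inn l,
     cost (W l) = 0 & exists2 e : edge H, inl e \in inn l & separates e (y l) (z l)]} ->
  (forall e, \sum_l occ (inl e) (items (p l))
             + \sum_(l in O) occ (inl e) (inn l) <= 1) ->
  (forall p' : I -> seq (edge H * vertex H), (forall l, is_walk (x l) (p' l) b) ->
     (forall l, occ (inr b) (items (p' l)) <= 1) ->
     (forall t, t != inr b -> \sum_l occ t (items (p' l))
        <= \sum_l occ t (items (p l)) + \sum_(l in O) occ t (inn l)) ->
     \sum_l cost (p l) <= \sum_l cost (p' l)) ->
  O = set0.
Proof.
move=> pw pb finj fO dec walks nob disj min.
pose p' l := if l \in O then A l ++ W l ++ C l else p l.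
have fin l : l \in O -> f l \in O by move=> lO; rewrite -fO imset_f.
(* For an additive [phi], the exchange trades the total over the [M l] for the total over the [W l],
   because [f] permutes the tails [B l]. *)
have shift (phi : seq (edge H * vertex H) -> nat) :
    (forall q r, phi (q ++ r) = phi q + phi r) ->
    \sum_l phi (p' l) + \sum_(l in O) phi (M l)
    = \sum_l phi (p l) + \sum_(l in O) phi (W l).
  move=> phiD.
  rewrite (bigID (mem O)) [in RHS](bigID (mem O)) /=.
  rewrite (eq_bigr (fun l => phi (A l) + phi (W l) + phi (C l))); last first.
    by move=> l lO; rewrite /p' lO !phiD addnA.
  rewrite [X in _ + X + _ = _](eq_bigr (fun l => phi (p l))); last first.
    by move=> l /negPf lO; rewrite /p' lO.
  rewrite [X in _ = X + _ + _](eq_bigr (fun l => phi (A l) + phi (B l))); last first.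
    by move=> l /dec[-> _ _ _]; rewrite phiD.
  have : \sum_(l in O) phi (B l) = \sum_(l in O) phi (M l) + \sum_(l in O) phi (C l).
    rewrite -{1}fO big_imset //= -big_split /=.
    by apply: eq_bigr => l /dec[_ -> _ _]; rewrite phiD.
  rewrite !big_split /=; lia.
have countW t l : l \in O -> occ t (items (W l)) =
    occ t (inn l) + occ t [:: inr (z l)].
  by move=> /dec[_ _ -> _]; rewrite occ_rcons.
(* The new visit to [z l] at the end of [W l] is paid for by the dropped [M l], which contains
   [z l]. *)
have countM t l : l \in O -> occ t [:: inr (z l)] <= occ t (items (M l)).
  by move=> /dec[_ _ _ zM]; apply: occ1_le.
have p'w l : is_walk (x l) (p' l) b.
  rewrite /p'; case: ifP => // lO; have [Aw Ww _ Cw] := walks _ lO.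
  exact: walk_cat Aw (walk_cat Ww Cw).
have p'b l : occ (inr b) (items (p' l)) <= 1.
  rewrite /p'; case: ifP => // lO; have [bA bi _ _] := nob _ lO.
  rewrite !occ_cat_items countW // (occ_eq0 bA) (occ_eq0 bi).
  have [pfl _ _ _] := dec _ (fin _ lO); have [_ Bfl _ _] := dec _ lO.
  have := pb (f l); rewrite pfl Bfl !occ_cat_items.
  by have := countM (inr b) _ lO; lia.
have p't t : t != inr b -> \sum_l occ t (items (p' l))
    <= \sum_l occ t (items (p l)) + \sum_(l in O) occ t (inn l).
  move=> _; have := shift _ (occ_cat_items t).
  rewrite [X in _ = _ + X](eq_bigr _ (fun l => @countW t l)) big_split /=.
  have : \sum_(l in O) occ t [:: inr (z l)] <= \sum_(l in O) occ t (items (M l)).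
    by apply: leq_sum => l /countM.
  lia.
(* The [W l] cost nothing, so the exchange saves exactly the cost of the [M l], which minimality
   forces to be zero. *)
have M0 l : l \in O -> cost (M l) = 0.
  move=> lO; have := min _ p'w p'b p't; have := shift _ cost_cat.
  rewrite [X in _ = _ + X](eq_bigr (fun=> 0)); last by move=> k /nob[].
  by rewrite (bigD1 l lO) /= sum_nat_const muln0; lia.
apply/eqP; apply: contraT => /set0Pn[l0 l0O].
(* By [disj], this [e] occurs only in [inn l0], so no [M l] and no other [W l] changes sides. *)
have [_ _ _ [e einn [s sl0 se]]] := nob _ l0O.
have en := disj e.
have e0 : 0 < occ (inl e) (inn l0) by rewrite occ_gt0.
have sM l : l \in O -> s (y (f l)) = s (z l).
  move=> lO; have [_ _ Mw _] := walks _ lO.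
  apply: walk_same_side se Mw (M0 _ lO) _.
  apply: notin_occ; move: en.
  have [pfl _ _ _] := dec _ (fin _ lO); have [_ Bfl _ _] := dec _ lO.
  rewrite (bigD1 (f l)) //= (bigD1 l0 l0O) /= pfl Bfl !occ_cat_items; lia.
have sW l : l \in O -> l != l0 -> s (y l) = s (z l).
  move=> lO ll0; have [_ Ww _ _] := walks _ lO; have [_ _ Wc _] := nob _ lO.
  apply: walk_same_side se Ww Wc _; apply: notin_occ; rewrite countW // occ1 addn0.
  move: en; rewrite (bigD1 l0 l0O) /= [X in _ + (_ + X)](bigD1 l) /= ?lO //; lia.
(* Through the [M l], the values of [s] at the [y l] and at the [z l] have the same sum over [O].
   They agree termwise except at [l0], hence also there, against [sl0]. *)
have : \sum_(l in O) s (y l) = \sum_(l in O) s (z l).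
  rewrite -{1}fO big_imset //=; apply: eq_bigr => l lO; by rewrite sM.
rewrite (bigD1 l0 l0O) [in RHS](bigD1 l0 l0O) /=.
rewrite (eq_bigr (fun l => nat_of_bool (s (z l)))); last first.
  by move=> l /andP[lO ll0]; rewrite sW.
by move/addIn; move: sl0; case: (s (y l0)); case: (s (z l0)).
Qed.

End Exchange.

(** * Sweeping with a hole *)

Section Holes.

Variables (H : multigraph) (b : vertex H) (F : {set edge H}) (I : finType).
Implicit Types (x y u v : vertex H) (e : edge H) (p q w : seq (edge H * vertex H)).
Implicit Types (D : {set vertex H}).
Variables (mate : vertex H -> vertex H) (jump : vertex H -> seq (edge H * vertex H)).
Variable inner : vertex H -> seq (edge H + vertex H).

(** Every jump is recorded at both of its ends, in opposite directions: [mate] is a fixed-point-free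
    involution of [D]. Dropping the last vertex makes [inner] the same multiset for both
    directions. *)
Record jump_system D : Prop := JumpSystem {
  mate_in : {in D, forall u, mate u \in D};
  mateK : {in D, forall u, mate (mate u) = u};
  mate_neq : {in D, forall u, mate u != u};
  jump_walk : {in D, forall u, is_walk u (jump u) (mate u)};
  jump_items : {in D, forall u, items (jump u) = rcons (inner u) (inr (mate u))};
  inner_mate : {in D, forall u, perm_eq (inner (mate u)) (inner u)};
  jump_cost : {in D, forall u, cost F (jump u) = 0};
  jump_sep : {in D, forall u, exists2 e : edge H,
                inl e \in inner u & separates F e u (mate u)}
}.

Lemma jump_systemD1 D u : jump_system D -> u \in D ->
  jump_system (D :\ u :\ mate u).
Proof.
move=> js uD; have sub v : v \in D :\ u :\ mate u -> v \in D.
  by rewrite !inE => /and3P[].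
split; try by move=> v /sub; case: js => *; auto.
move=> v; rewrite !inE => /and3P[vm vu vD]; rewrite (mate_in js) // andbT.
by apply/andP; split; [apply: contraNneq vu => h | apply: contraNneq vm => h];
  rewrite -(mateK js vD) h ?(mateK js).
Qed.

Implicit Types (xs : I -> vertex H) (ps : I -> seq (edge H * vertex H)).

(* Each jump has both its ends in [D], so it is counted twice; the factor 2 gives
   the routes the same weight. *)
Definition load D ps t :=
  2 * \sum_l occ t (items (ps l)) + \sum_(u in D) occ t (inner u).

(** The starting points [xs] are free, so that what remains of the paths during the sweep is an
    instance again. In a jump system, load at most 2 means that paths and jump interiors together
    use every item other than [b] at most once. *)
Record linked D xs ps : Prop := Linked {
  linked_walk : forall l, is_walk (xs l) (ps l) b;
  linked_end : forall l, occ (inr b) (items (ps l)) <= 1;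
  linked_load : forall t, t != inr b -> load D ps t <= 2;
  linked_inner : {in D, forall u, inr b \notin inner u};
  linked_neq : {in D, forall u, u != b};
  linked_mem : {in D, forall u, exists l, inr u \in items (ps l)}
}.

(** Competitors are confined to the items that the paths and jumps provide. A competitor of the
    remaining parts then extends by the swept parts, so minimality survives the sweep. *)
Definition cheapest D xs ps := forall ps',
  (forall l, is_walk (xs l) (ps' l) b) ->
  (forall l, occ (inr b) (items (ps' l)) <= 1) ->
  (forall t, t != inr b -> 2 * \sum_l occ t (items (ps' l)) <= load D ps t) ->
  \sum_l cost F (ps l) <= \sum_l cost F (ps' l).

Definition covered D ps e :=
  (exists l, inl e \in items (ps l)) \/ (exists2 u, u \in D & inl e \in inner u).

(* [R h l] is the route that starts on [ps l] when the hole starts on [ps h]. *)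
Record hole_routes D xs ps (R : I -> I -> seq (edge H * vertex H)) : Prop :=
  HoleRoutes {
  route_walk : forall h l, l != h -> is_walk (xs l) (R h l) b;
  route_end : forall h l, l != h -> occ (inr b) (items (R h l)) <= 1;
  route_load : forall h t, t != inr b ->
    2 * \sum_(l | l != h) occ t (items (R h l)) <= load D ps t;
  route_cover : forall e, covered D ps e ->
    exists h l, l != h /\ inl e \in items (R h l)
}.

(* The jump between [ys i] and [ys j] is the first event of the sweep: [A] is the
   part of the paths already swept. *)
Lemma peel D xs ys ps A B (i j : I) : 1 < #|I| ->
  jump_system D -> linked D xs ps -> cheapest D xs ps -> i != j ->
  (forall l, ps l = A l ++ B l) ->
  (forall l, is_walk (xs l) (A l) (ys l)) ->
  (forall l, is_walk (ys l) (B l) b) ->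
  (forall l, inr b \notin items (A l)) ->
  (forall l, {in D, forall u, inr u \in items (A l) -> u \in [set ys i; ys j]}) ->
  ys i \in D -> mate (ys i) = ys j ->
  inr (ys i) \in items (A i) -> inr (ys j) \in items (A j) ->
  let D' := D :\ ys i :\ ys j in
  [/\ linked D' ys B, cheapest D' ys B &
      forall R', hole_routes D' ys B R' -> exists R, hole_routes D xs ps R].
Proof.
move=> I1 js lk ch ij pAB Aw Bw Ab AD iD mij iA jA D'.
have jD : ys j \in D by rewrite -mij (mate_in js).
have mji : mate (ys j) = ys i by rewrite -mij (mateK js).
have yij : ys j != ys i by rewrite -mij (mate_neq js).
have innj t : occ t (inner (ys j)) = occ t (inner (ys i)).
  by rewrite -mij; apply: occ_perm; apply: (inner_mate js).
(* The removed jump counts once at each of its two ends, hence the common factor 2. *)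
have loadE t : load D ps t =
    2 * (\sum_l occ t (items (A l)) + occ t (inner (ys i))) + load D' B t.
  rewrite /load (big_setD1 (ys i)) //= (big_setD1 (ys j)) /=; last by rewrite !inE yij.
  rewrite -/D'.
  rewrite innj (eq_bigr (fun l => occ t (items (A l)) + occ t (items (B l)))).
    by rewrite big_split /=; lia.
  by move=> l _; rewrite pAB occ_cat_items.
have subD u : u \in D' -> u \in D by rewrite !inE => /and3P[].
split.
- split => //.
  + by move=> l; have := linked_end lk l; rewrite pAB occ_cat_items; lia.
  + by move=> t /(linked_load lk); rewrite loadE; lia.
  + by move=> u /subD /(linked_inner lk).
  + by move=> u /subD /(linked_neq lk).
  + move=> u uD'; have [l] := linked_mem lk (subD _ uD'); rewrite pAB items_cat mem_cat.
    case/orP => [/(AD _ _ (subD _ uD'))|]; last by exists l.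
    by move: uD'; rewrite !inE => /and3P[/negPf-> /negPf->].
- move=> q qw qb ql.
  have := ch (fun l => A l ++ q l).
  have costD (r : I -> seq (edge H * vertex H)) :
      \sum_l cost F (A l ++ r l) = \sum_l cost F (A l) + \sum_l cost F (r l).
    by rewrite -big_split; apply: eq_bigr => l _; rewrite cost_cat.
  rewrite costD (eq_bigr _ (fun l _ => congr1 (cost F) (pAB l))) costD leq_add2l.
  apply=> [l|l|t tb].
  + exact: walk_cat (Aw l) (qw l).
  + by rewrite occ_cat_items (occ_eq0 (Ab l)) qb.
  + rewrite loadE (eq_bigr _ (fun l _ => occ_cat_items t (A l) (q l))) big_split /=.
    by have := ql _ tb; lia.
move=> R' hr.
(* If the initial hole [h] is [i] or [j], the route on the other of the two takes the jump to path
   [h]; otherwise nothing changes. In both cases the hole moves to [tperm i j h]. [tau h] sends the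
   path a route is on to the one it continues on, and [K h l] is the piece in between. *)
pose ends h := h \in [set i; j].
pose tau h := if ends h then tperm i j else 1%g.
pose K h l := if ends h && ends l then jump (ys l) else [::].
have tauK h : involutive (tau h).
  by rewrite /tau; case: ifP => _ l; rewrite ?tpermK ?perm1.
have tau_hole h : tau h h = tperm i j h.
  rewrite /tau /ends; case: ifPn => //; rewrite !inE perm1 => /norP[hi hj].
  by rewrite tpermD // eq_sym.
have tauN h l : l != h -> tau h l != tau h h by rewrite (inj_eq perm_inj).
have Kend h l : l != h -> ends h -> ends l -> ys h = mate (ys l) /\ ys l \in D.
  rewrite /ends !inE => lh /orP[] /eqP hE /orP[] /eqP lE; subst => //;
  by rewrite eqxx in lh.
have Kw h l : l != h -> is_walk (ys l) (K h l) (ys (tau h l)).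
  move=> lh; rewrite /K /tau; case: ifP => [/andP[hh ll]|].
    rewrite hh; have [yh lD] := Kend _ _ lh hh ll.
    suff -> : tperm i j l = h by rewrite yh; apply: (jump_walk js).
    by move: hh ll lh; rewrite /ends !inE => /orP[] /eqP -> /orP[] /eqP ->;
      rewrite ?eqxx ?tpermL ?tpermR.
  case: ifP; rewrite ?perm1 /ends /= ?eqxx // !inE => _ /norP[li lj].
  by rewrite tpermD // eq_sym.
(* The last vertex of the jump is charged to [A h], the segment that the hole leaves free. *)
have Ksum h t : \sum_(l | l != h) occ t (items (K h l)) <=
    occ t (inner (ys i)) + occ t (items (A h)).
  case: (boolP (ends h)) => hh; last first.
    by rewrite big1 // => l _; rewrite /K (negPf hh).
  have [k [kh kk yk]] : exists k,
      [/\ k != h, ends k & forall l, ends l -> l != h -> l = k].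
    move: hh; rewrite /ends !inE => /orP[]/eqP->.
    - exists j; split=> [||l]; rewrite ?inE ?eqxx ?orbT //; first by rewrite eq_sym.
      by case/orP => /eqP-> //; rewrite eqxx.
    - exists i; split=> [||l]; rewrite ?inE ?eqxx //.
      by case/orP => /eqP-> //; rewrite eqxx.
  rewrite (bigD1 k) //= big1 ?addn0; last first.
    move=> l /andP[lh lk']; rewrite /K hh; case: ifP => // /yk/(_ lh) e.
    by rewrite e eqxx in lk'.
  have [yh kD] := Kend _ _ kh hh kk.
  rewrite /K hh kk (jump_items js) // occ_rcons -yh.
  have -> : occ t (inner (ys k)) = occ t (inner (ys i)).
    by move: kk; rewrite /ends !inE => /orP[]/eqP-> //.
  rewrite leq_add2l; apply: occ1_le.
  by move: hh; rewrite /ends !inE => /orP[]/eqP->.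
have innK u e : u \in [set ys i; ys j] -> inl e \in inner u ->
    exists h l, l != h /\ inl e \in items (K h l).
  move=> uij eu; have eij : inl e \in items (jump (ys j)).
    rewrite (jump_items js) // mem_rcons in_cons; apply/orP; right.
    by rewrite -occ_gt0; move: uij eu; rewrite !inE => /orP[]/eqP->;
      rewrite -occ_gt0 // innj.
  by exists i, j; rewrite eq_sym ij /K /ends !inE !eqxx orbT.
exists (fun h l => A l ++ K h l ++ R' (tperm i j h) (tau h l)); split.
- move=> h l lh; apply: walk_cat (Aw l) (walk_cat (Kw _ _ lh) _).
  by apply: (route_walk hr); rewrite -tau_hole tauN.
- move=> h l lh; rewrite !occ_cat_items (occ_eq0 (Ab l)).
  have -> : occ (inr b) (items (K h l)) = 0.
    rewrite /K; case: ifP => // /andP[hh ll]; have [yh lD] := Kend _ _ lh hh ll.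
    rewrite (jump_items js) // occ_rcons (occ_eq0 (linked_inner lk lD)) occ1.
    rewrite (inj_eq (@inr_inj _ _)) eq_sym (negPf (linked_neq lk _)) //.
    exact: (mate_in js).
  by apply: (route_end hr); rewrite -tau_hole tauN.
- move=> h t tb.
  have := route_load hr (tperm i j h) tb; rewrite loadE.
  rewrite -(tau_hole h) [X in _ * X <= _](reindex_inj (@perm_inj _ (tau h))) /=.
  rewrite (eq_bigl (fun l => l != h)); last first.
    by move=> l; rewrite (inj_eq perm_inj).
  rewrite tau_hole; have := Ksum h t.
  have -> : \sum_(l | l != h)
      occ t (items (A l ++ K h l ++ R' (tperm i j h) (tau h l))) =
      \sum_(l | l != h) occ t (items (A l)) + \sum_(l | l != h) occ t (items (K h l))
      + \sum_(l | l != h) occ t (items (R' (tperm i j h) (tau h l))).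
    by rewrite -!big_split; apply: eq_bigr => l _; rewrite !occ_cat_items addnA.
  by rewrite [\sum_l occ t (items (A l))](bigD1 h) //=; lia.
move=> e; have [k0 _] : exists h : I, true by exists i.
have split_cover : covered D ps e -> (exists l, inl e \in items (A l)) \/
   covered D' B e \/ exists2 u, u \in [set ys i; ys j] & inl e \in inner u.
  case=> [[l]|[u uD eu]].
    rewrite pAB items_cat mem_cat => /orP[eA|eB]; first by left; exists l.
    by right; left; left; exists l.
  case: (boolP (u \in [set ys i; ys j])) => uij; first by right; right; exists u.
  right; left; right; exists u => //.
  by move: uij; rewrite !inE negb_or uD andbT andbC.
(* An edge of [A l] is used as soon as the hole starts elsewhere, a remaining edge once its hole is
   pulled back through the swap, and an edge of the jump when the hole starts at [i]. *)
case/split_cover => [[l el]|[cov|[u uij eu]]].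
- have [h hl] : exists h, h != l.
    case: (eqVneq i l) => [il|]; last by exists i.
    by exists j; rewrite -il eq_sym.
  by exists h, l; rewrite eq_sym hl !items_cat !mem_cat el.
- have [h [l [lh el]]] := route_cover hr cov.
  exists (tperm i j h), (tau (tperm i j h) l); split.
    by rewrite -(inj_eq (@perm_inj _ (tau (tperm i j h)))) tauK tau_hole tpermK.
  by rewrite tauK tpermK !items_cat !mem_cat el !orbT.
- have [h [l [lh el]]] := innK _ _ uij eu.
  by exists h, l; rewrite lh !items_cat !mem_cat el orbT.
Qed.

(** This is [exchange] with the jumps as the [W l]. As no two of the [ys l] are mates, each jump is
    taken from one end only while [load] counts it at both, so the rerouted paths fit into the
    load. *)
Lemma no_cyclic_exchange D xs ys ps A B (O : {set I}) f M C :
  jump_system D -> linked D xs ps -> cheapest D xs ps ->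
  {in O &, injective f} -> f @: O = O ->
  (forall l, ps l = A l ++ B l) ->
  {in O, forall l, [/\ is_walk (xs l) (A l) (ys l), inr b \notin items (A l),
     ys l \in D & inr (ys l) \in items (A l)]} ->
  {in O, forall l, [/\ B (f l) = M l ++ C l, is_walk (ys (f l)) (M l) (mate (ys l)),
     is_walk (mate (ys l)) (C l) b & inr (mate (ys l)) \in items (M l)]} ->
  {in O &, forall k l, mate (ys k) != ys l} ->
  O = set0.
Proof.
move=> js lk ch finj fO pAB hA hM nready.
have yinj : {in O &, injective ys}.
  move=> k l kO lO ykl; apply: contraTeq isT => /negP/negP kl.
  have [_ _ yD yA] := hA _ kO; have [_ _ _ yA'] := hA _ lO.
  have /(linked_load lk) : inr (ys k) != inr b :> (edge H + vertex H).
    by rewrite (inj_eq (@inr_inj _ _)) (linked_neq lk).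
  rewrite /load (bigD1 k) //= (bigD1 l) /=; last by rewrite eq_sym.
  rewrite ykl in yA *; rewrite !pAB !occ_cat_items.
  by have := occ_vertex_gt0 yA; have := occ_vertex_gt0 yA'; lia.
have twice t : 2 * \sum_(l in O) occ t (inner (ys l)) <= \sum_(u in D) occ t (inner u).
  have yD : ys @: O \subset D by apply/subsetP => u /imsetP[l /hA[_ _ ? _] ->].
  have mD : mate @: (ys @: O) \subset D :\: ys @: O.
    apply/subsetP => u /imsetP[v /imsetP[l lO ->] ->]; rewrite inE.
    have [_ _ yD' _] := hA _ lO; rewrite (mate_in js) // andbT.
    apply/imsetP => -[k kO e]; have := nready _ _ lO kO.
    by rewrite e eqxx.
  have mE : \sum_(u in mate @: (ys @: O)) occ t (inner u)
      = \sum_(l in O) occ t (inner (ys l)).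
    rewrite big_imset /=; last first.
      move=> u v /(subsetP yD) uD /(subsetP yD) vD e.
      by rewrite -(mateK js uD) e (mateK js vD).
    rewrite big_imset //=; apply: eq_bigr => l /hA[_ _ lD _].
    by apply: occ_perm; apply: (inner_mate js).
  rewrite (big_setID (ys @: O)) /= (setIidPr yD).
  rewrite [X in _ + X](big_setID (mate @: (ys @: O))) /= (setIidPr mD) mE big_imset //=.
  lia.
apply: (@exchange H b F I xs ps A B (fun l => jump (ys l)) M C O f ys
         (fun l => mate (ys l)) (fun l => inner (ys l))) => //.
- exact: linked_walk lk.
- exact: linked_end lk.
- move=> l lO; have [_ _ yD _] := hA _ lO; have [? _ _ ?] := hM _ lO.
  by split=> //; apply: (jump_items js).
- move=> l lO; have [? _ yD _] := hA _ lO; have [_ ? ? _] := hM _ lO.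
  by split=> //; apply: (jump_walk js).
- move=> l lO; have [_ ? yD _] := hA _ lO; split=> //.
  + exact: (linked_inner lk).
  + exact: (jump_cost js).
  + exact: (jump_sep js).
- move=> e; have := twice (inl e); have := @linked_load _ _ _ lk (inl e) isT.
  by rewrite /load /=; lia.
- move=> p' p'w p'b p't; apply: ch => // t tb; have := p't t tb.
  by rewrite /load /=; have := twice t; lia.
Qed.

(** Induction on the number of jump ends. Either two of the first jump ends on the paths are mates
    and [peel] applies, or each of them jumps strictly beyond the first jump end of some path;
    following these jumps yields a cyclic exchange. *)
Lemma hole_routes_exist D xs ps : 1 < #|I| ->
  jump_system D -> linked D xs ps -> cheapest D xs ps ->
  exists R, hole_routes D xs ps R.
Proof.
move=> I1; have [n] := ubnP #|D|; elim: n => // n IHn in D xs ps *.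
move=> Dn js lk ch.
have [D0|/set0Pn[u0 u0D]] := eqVneq D set0.
  exists (fun _ => ps); split => [h l _|h l _|h t tb|e].
  - exact: linked_walk lk l.
  - exact: linked_end lk l.
  - by rewrite /load [\sum_l _](bigD1 h) //=; lia.
  - case=> [[l el]|[u]]; last by rewrite D0 inE.
    have /card_gt1P[i [j [_ _ ij]]] := I1.
    case: (eqVneq i l) => [il|il]; last by exists i, l; rewrite eq_sym.
    by exists j, l; rewrite -il ij il.
pose I0 := [set l | [exists u in D, inr u \in items (ps l)]].
(* Paths without jump ends get a dummy cut with nothing after it, so that the decomposition holds
   for every [l]. *)
have /fin_all_exists[T hT] l :
  exists T : seq (edge H * vertex H) * seq (edge H * vertex H) * vertex H,
    ps l = T.1.1 ++ T.1.2 /\ (l \in I0 ->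
      [/\ is_walk (xs l) T.1.1 T.2, is_walk T.2 T.1.2 b, T.2 \in D,
        inr T.2 \in items T.1.1 & {in D, forall v, inr v \in items T.1.1 -> v = T.2}]).
  case: (boolP (l \in I0)) => lI.
    have [|q [r [u [[-> xq ur uD uq] fu]]]] := @walk_first _ D _ _ _ (linked_walk lk l).
      by move: lI; rewrite inE => /existsP[u /andP[uD up]]; exists u.
    by exists (q, r, u); split.
  by exists (ps l, [::], b); rewrite cats0; split.
pose A l := (T l).1.1; pose B l := (T l).1.2; pose y l := (T l).2.
have {hT}[pAB hT] : (forall l, ps l = A l ++ B l) /\ (forall l, l \in I0 ->
    [/\ is_walk (xs l) (A l) (y l), is_walk (y l) (B l) b, y l \in D,
      inr (y l) \in items (A l) & {in D, forall v, inr v \in items (A l) -> v = y l}]).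
  by split=> l; case: (hT l).
have Ab l : l \in I0 -> inr b \notin items (A l).
  move=> /hT[_ yB yD _ _].
  apply: notin_left (walk_end_mem yB (linked_neq lk yD)).
  by have := linked_end lk l; rewrite pAB occ_cat_items.
have memI0 u l : u \in D -> inr u \in items (ps l) -> l \in I0.
  by move=> uD ul; rewrite inE; apply/existsP; exists u; rewrite uD.
case: (boolP [exists i in I0, [exists j in I0, mate (y i) == y j]]) => [|nready].
  case/existsP=> i /andP[iI /existsP[j /andP[jI /eqP mij]]].
  have [iA iB iD iyA ifirst] := hT _ iI; have [jA jB jD jyA jfirst] := hT _ jI.
  have ij : i != j by apply: contraTneq (mate_neq js iD) => e; rewrite mij e eqxx.
  (* Only the paths [i] and [j] advance; on the others the swept part is empty and the starting
     point is kept. *)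
  pose IJ := [set i; j].
  have IJ0 l : l \in IJ -> l \in I0 by rewrite in_set2 => /orP[]/eqP->.
  have := @peel D xs (fun l => if l \in IJ then y l else xs l) ps
     (fun l => if l \in IJ then A l else [::]) (fun l => if l \in IJ then B l else ps l)
     i j I1 js lk ch ij.
  rewrite !inE !eqxx orbT /=; case=> //.
  - by move=> l; case: ifP.
  - by move=> l; case: ifP => [/IJ0/hT[]|_] //=.
  - by move=> l; case: ifP => [/IJ0/hT[]|_] //; apply: (linked_walk lk).
  - by move=> l; case: ifP => [/IJ0/Ab|].
  - move=> l u uD; case: ifP => // lIJ uA; have [_ _ _ _ first_l] := hT _ (IJ0 _ lIJ).
    rewrite (first_l _ uD uA); move: lIJ; rewrite !inE.
    by case/orP=> /eqP->; rewrite eqxx ?orbT.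
  move=> lk' ch' build; have js' := jump_systemD1 js iD; rewrite mij in js'.
  have [|R' hR'] := IHn _ _ _ _ js' lk' ch'; last exact: build hR'.
  rewrite ltnS in Dn; apply: leq_trans Dn.
  exact: leq_ltn_trans (subset_leq_card (subD1set _ _)) (proper_card (properD1 iD)).
exfalso.
(* The first component is a path through the mate of [y l]. As that mate is not a first jump end, it
   lies beyond the cut of this path. *)
have /fin_all_exists[T' hT'] l :
  exists T : I * (seq (edge H * vertex H) * seq (edge H * vertex H)),
    l \in I0 -> [/\ T.1 \in I0, B T.1 = T.2.1 ++ T.2.2,
      is_walk (y T.1) T.2.1 (mate (y l)), is_walk (mate (y l)) T.2.2 b
      & inr (mate (y l)) \in items T.2.1].
  case: (boolP (l \in I0)) => lI; last by exists (l, (A l, A l)).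
  have [_ _ yD _ _] := hT _ lI; have mD := mate_in js yD.
  have [k mk] := linked_mem lk mD; have kI := memI0 _ _ mD mk.
  have [_ kB _ _ first_k] := hT _ kI.
  have mB : inr (mate (y l)) \in items (B k).
    move: mk; rewrite pAB items_cat mem_cat => /orP[/(first_k _ mD) e|//].
    case/negP: nready; apply/existsP; exists l; rewrite lI /=.
    by apply/existsP; exists k; rewrite kI e eqxx.
  have [q [r [Bk ? ? ?]]] := walk_split kB mB.
  by exists (k, (q, r)); split.
pose f l := (T' l).1.
(* A minimal nonempty set closed under [f] equals its image, so [f] permutes it: this is the cyclic
   pattern to reroute along. *)
pose closed (O : {set I}) := [&& O != set0, O \subset I0 & f @: O \subset O].
have closed0 : closed I0.
  apply/and3P; split=> //; last by apply/subsetP => _ /imsetP[l /hT'[? _ _ _ _] ->].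
  have [l ul] := linked_mem lk u0D.
  by apply/set0Pn; exists l; apply: memI0 ul.
have [O /minsetP[/and3P[O0 OI fO] minO] _] := minset_exists closed0.
have {}fO : f @: O = O.
  apply: minO => //; apply/and3P; split; last exact: imsetS.
    by have [l lO] := set0Pn _ O0; apply/set0Pn; exists (f l); apply: imset_f.
  exact: subset_trans fO OI.
case/eqP: O0; apply: (@no_cyclic_exchange D xs y ps A B O f
  (fun l => (T' l).2.1) (fun l => (T' l).2.2)) => //.
- by apply/imset_injP; rewrite fO.
- by move=> l /(subsetP OI) lI; have [] := hT _ lI; have := Ab _ lI.
- by move=> l /(subsetP OI) /hT'[].
- move=> k l /(subsetP OI) kI /(subsetP OI) lI; apply: contra nready => ykl.
  apply/existsP; exists k; rewrite kI; apply/existsP; exists l; by rewrite lI.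
Qed.

End Holes.

(** * The jumps of the path *)

Section Jumps.

Variables (H : multigraph) (a b : vertex H) (I : finType).
Variables (Q : I -> seq (edge H * vertex H)) (P : seq (edge H * vertex H)).
Implicit Types (x y u v : vertex H) (e : edge H) (p q w : seq (edge H * vertex H)).
Implicit Types (t : edge H + vertex H) (n : seq (edge H + vertex H)).

Hypothesis ab : a != b.
Hypothesis Pw : is_walk a P b.
Hypothesis Pu : uniq (a :: [seq s.2 | s <- P]).

(** Internally disjoint paths from [a] to [b] as occurrence bounds, edges included. Since [items]
    omits the initial vertex, only [b] is shared, and [a] must not occur at all. *)
Definition linkage (Q' : I -> seq (edge H * vertex H)) : Prop :=
  [/\ forall l, is_walk a (Q' l) b,
      forall l, occ (inr b) (items (Q' l)) <= 1,
      forall t, t != inr b -> \sum_l occ t (items (Q' l)) <= 1 &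
      forall l, inr a \notin items (Q' l)].

Hypothesis Ql : linkage Q.
Hypothesis Qmin : forall Q', linkage Q' ->
  \sum_l cost (edge_set P) (Q l) <= \sum_l cost (edge_set P) (Q' l).

Definition used t : bool := [exists l, t \in items (Q l)].
Definition touched : {set vertex H} := [set v | (v == a) || used (inr v)].

Lemma usedP t : reflect (exists l, t \in items (Q l)) (used t).
Proof. exact: existsP. Qed.

Lemma used_ends e u v : used (inl e) -> joins e u v -> u \in touched.
Proof.
case/usedP=> l el euv; have [/(_ l) Qw _ _ _] := Ql.
have := walk_edge_end Qw el euv; rewrite !inE => /orP[->//|ul].
by apply/orP; right; apply/usedP; exists l; rewrite mem_items_vertex.
Qed.

Lemma P_items_uniq : uniq (items P).
Proof. exact: path_items_uniq Pw Pu. Qed.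

(** Only the interior [n] is kept off the linkage; that the ends [u] and [v] are touched is a
    separate hypothesis where it matters. *)
Record is_jump X w Y u v n : Prop := IsJump {
  jump_dec : P = X ++ w ++ Y;
  jump_pre : is_walk a X u;
  jump_path : is_walk u w v;
  jump_inner : items w = rcons n (inr v);
  jump_unused : forall t, t \in n -> ~~ used t;
  jump_avoids_a : inr a \notin n
}.

Lemma jump_occ X w Y u v n t : is_jump X w Y u v n -> occ t n <= occ t (items P).
Proof.
by move=> jw; rewrite (jump_dec jw) !occ_cat_items (jump_inner jw) occ_rcons; lia.
Qed.

Lemma jump_cost0 X w Y u v n : is_jump X w Y u v n -> cost (edge_set P) w = 0.
Proof.
move=> jw; apply/eqP; rewrite -leqn0 leqNgt -has_count; apply/hasPn => e ew.
by rewrite negbK inE (jump_dec jw) !map_cat !mem_cat ew orbT.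
Qed.

(** The first edge of the jump cuts [P] in two, and the side of a vertex tells whether it lies on
    the part up to [u]; every other edge of [P] stays on one side. *)
Lemma jump_separates X w Y u v n : is_jump X w Y u v n ->
  exists2 e : edge H, inl e \in n & separates (edge_set P) e u v.
Proof.
move=> jw; have Xw := jump_pre jw; have := jump_path jw; have := jump_inner jw.
case: w jw => [|[e z] w] jw; first by case: n jw.
case: n jw => [|t n] jw //= [<- eqn] /andP[euz zv].
exists e; first exact: mem_head.
have PE := jump_dec jw; move: Pu; rewrite PE map_cat -cat_cons cat_uniq.
case/and3P=> _ /hasPn dis _.
have Pw' := Pw; rewrite PE in Pw'; have [u' Xw' wYw] := walk_catE Pw'.
have {u' Xw'} wYw : is_walk u (((e, z) :: w) ++ Y) b by rewrite (walk_end Xw Xw').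
have zb : is_walk z (w ++ Y) b by case/andP: wYw.
exists (fun x => x \in a :: [seq s.2 | s <- X]).
  rewrite (walk_end_in Xw) eq_sym eqb_id; apply: dis.
  have := walk_end_in zv; rewrite !map_cat !in_cons mem_cat.
  by case/orP => ->; rewrite ?orbT.
move=> e' x y; rewrite inE !map_cat !mem_cat => eP e'e exy.
have {eP e'e} [eX|eY] : inl e' \in items X \/ inl e' \in items (w ++ Y).
  rewrite !mem_items_edge map_cat mem_cat; move: eP; rewrite in_cons (negPf e'e) /=.
  by case/orP; [left | right].
  have eyx : joins e' y x by rewrite joinsC.
  by rewrite (walk_edge_end Xw eX exy) (walk_edge_end Xw eX eyx).
have eyx : joins e' y x by rewrite joinsC.
have out s : s \in z :: [seq s.2 | s <- w ++ Y] ->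
    (s \in a :: [seq s.2 | s <- X]) = false.
  by move=> /dis/negPf.
by rewrite (out _ (walk_edge_end zb eY exy)) (out _ (walk_edge_end zb eY eyx)).
Qed.

Lemma jump_disjoint X w Y u v n t : is_jump X w Y u v n -> t != inr b ->
  \sum_l occ t (items (Q l)) + occ t n <= 1.
Proof.
move=> jw tb; have [_ _ Q1 _] := Ql; case: (boolP (t \in n)) => tn.
  rewrite big1 ?add0n; last first.
    move=> l _; apply: occ_eq0; apply: contra (jump_unused jw tn) => tl.
    by apply/usedP; exists l.
  by apply: leq_trans (jump_occ t jw) _; apply: occ_uniq P_items_uniq.
by rewrite (occ_eq0 tn) addn0 Q1.
Qed.

(** The exchange with a single path: replacing [M] by the jump saves an edge outside [P], because an
    [M] inside [P] would join the two sides of an edge of the jump without using it. *)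
Lemma no_self_jump X w Y u v n l A M C : is_jump X w Y u v n ->
  Q l = A ++ M ++ C -> is_walk a A u -> is_walk u M v -> is_walk v C b ->
  inr v \in items M -> inr b \notin items A -> False.
Proof.
move=> jw QE Aw Mw Cw vM bA; have [Qw Qb Q1 Qa] := Ql.
have bn : inr b \notin n.
  apply/negP => /(jump_unused jw)/usedP; apply; exists l.
  exact: walk_end_mem (Qw l) ab.
have /setP/(_ l) : [set l] = set0 :> {set I}; last by rewrite !inE eqxx.
apply: (@exchange H b (edge_set P) I (fun=> a) Q (fun=> A) (fun=> M ++ C) (fun=> w)
   (fun=> M) (fun=> C) [set l] id (fun=> u) (fun=> v) (fun=> n)) => //.
- by rewrite imset_id.
- by move=> k /set1P->; split=> //; apply: jump_inner jw.
- by move=> k _; split=> //; apply: jump_path jw.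
- move=> k _; split=> //; first exact: jump_cost0 jw.
  exact: jump_separates jw.
- by move=> e; rewrite big_set1; apply: jump_disjoint jw _.
- move=> p' p'w p'b p't; apply: Qmin; split=> // [t tb|k].
    by apply: leq_trans (p't t tb) _; rewrite big_set1; apply: jump_disjoint jw _.
  have Qa0 : \sum_l' occ (inr a) (items (Q l')) = 0.
    by rewrite big1 // => l' _; rewrite occ_eq0.
  have na : occ (inr a) n = 0 by apply: occ_eq0 (jump_avoids_a jw).
  have := p't (inr a) ab; rewrite big_set1 /= Qa0 na leqn0 (bigD1 k) //= addn_eq0.
  by case/andP=> /eqP h _; apply: notin_occ.
Qed.

Lemma jump_fresh X w Y u v n x : is_jump X w Y u v n ->
  x \in a :: [seq s.2 | s <- X] -> x \notin [seq s.2 | s <- w ++ Y].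
Proof.
move=> jw xX; move: Pu; rewrite (jump_dec jw) map_cat -cat_cons cat_uniq.
by case/and3P=> _ /hasPn dis _; apply: contraL xX => /dis.
Qed.

Lemma jump_end X w Y u v n : is_jump X w Y u v n -> v \in [seq s.2 | s <- w].
Proof. by move=> jw; rewrite -mem_items_vertex (jump_inner jw) mem_rcons mem_head. Qed.

(** [P] neither returns to [a] nor goes on after [b]. A jump leaving [a] or arriving at [b] would
    bypass part of a path through its other end, against [no_self_jump]. *)
Lemma jump_ends X w Y u v n : is_jump X w Y u v n -> u \in touched -> v \in touched ->
  [/\ u != v, u \notin [set a; b] & v \notin [set a; b]].
Proof.
move=> jw ut vt; have [Qw Qb _ Qa] := Ql.
have uX := walk_end_in (jump_pre jw); have vw := jump_end jw.
have vwY : v \in [seq s.2 | s <- w ++ Y] by rewrite map_cat mem_cat vw.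
have uv : u != v.
  by apply: contraTneq vwY => <-; apply: jump_fresh jw uX.
have va : v != a.
  by apply: contraTneq vwY => ->; apply: jump_fresh jw (mem_head _ _).
have ub : u != b.
  have Pw' := Pw; rewrite (jump_dec jw) in Pw'; have [u' Xw' wYw] := walk_catE Pw'.
  rewrite (walk_end Xw' (jump_pre jw)) in wYw.
  have := walk_end_in wYw; rewrite in_cons eq_sym; case: (eqVneq u b) => //= ub.
  have [v' ww' Yw] := walk_catE wYw; rewrite (walk_end ww' (jump_path jw)) in Yw.
  have bwY : b \in [seq s.2 | s <- w ++ Y].
    have := walk_end_in Yw; rewrite in_cons map_cat mem_cat => /orP[/eqP->|->].
      by rewrite vw.
    by rewrite orbT.
  by rewrite -ub in bwY; move: bwY; rewrite (negPf (jump_fresh jw uX)).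
have vused : used (inr v) by move: vt; rewrite inE (negPf va).
have ua : u != a.
  apply/eqP => ua; have [l vl] := usedP _ vused.
  have [q [r [Ql' qw rw vq]]] := walk_split (Qw l) vl.
  by apply: (@no_self_jump _ _ _ _ _ _ l [::] q r jw); rewrite //= ?ua ?eqxx.
have uused : used (inr u) by move: ut; rewrite inE (negPf ua).
split=> //; first by rewrite in_set2 negb_or ua.
rewrite in_set2 negb_or va; apply/eqP => vb; have [l ul] := usedP _ uused.
have [q [r [Ql' qw rw uq]]] := walk_split (Qw l) ul.
have br := walk_end_mem rw ub.
apply: (@no_self_jump _ _ _ _ _ _ l q r [::] jw); rewrite ?cats0 // ?vb //= ?eqxx.
by apply: notin_left br; have := Qb l; rewrite Ql' occ_cat_items.
Qed.

(** * Classes of jumps and the splitting of [P] *)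

Record jumps := Jumps {
  jmate : vertex H -> vertex H;
  jwalk : vertex H -> seq (edge H * vertex H);
  jinner : vertex H -> seq (edge H + vertex H);
  jdom : {set vertex H}
}.

(** [V] confines the jump ends and [p] the interiors, so that a jump on an earlier part of [P] can
    be added without a clash. The factor 2 again counts each jump at both ends. *)
Record jumps_along (V : seq (vertex H)) p (J : jumps) : Prop := JumpsAlong {
  along_system : jump_system (edge_set P) (jmate J) (jwalk J) (jinner J) (jdom J);
  along_touched : {in jdom J, forall u, u \in touched};
  along_ends : {in jdom J, forall u, u \notin [set a; b]};
  along_sub : {in jdom J, forall u, u \in V};
  along_load : forall t, \sum_(u in jdom J) occ t (jinner J u) <= 2 * occ t (items p);
  along_unused : {in jdom J, forall u t, t \in jinner J u -> ~~ used t};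
  along_a : {in jdom J, forall u, inr a \notin jinner J u}
}.

Definition crossed J e := exists2 u, u \in jdom J & inl e \in jinner J u.

Lemma jumps_along_nil V p : exists2 J, jumps_along V p J & jdom J = set0.
Proof.
exists (Jumps id (fun=> [::]) (fun=> [::]) set0) => //.
by split=> [|u|u|u|t|u|u]; rewrite ?inE //=; [split=> u; rewrite inE | rewrite big_set0].
Qed.

Lemma jumps_along_widen V V' p p' J : {subset V <= V'} ->
  (forall t, occ t (items p) <= occ t (items p')) ->
  jumps_along V p J -> jumps_along V' p' J.
Proof.
move=> sV sp [? ? ? sub load ? ?]; split=> // [u /sub/sV//|t].
by apply: leq_trans (load t) _; rewrite leq_pmul2l.
Qed.

Lemma jumps_along_add X w Y u v n V p J : is_jump X w Y u v n ->
  u \in touched -> v \in touched -> u \notin V -> v \notin V ->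
  jumps_along V p J -> exists J', [/\ jumps_along [:: u, v & V] (w ++ p) J',
    forall e, crossed J e -> crossed J' e & forall e, inl e \in n -> crossed J' e].
Proof.
move=> jw ut vt uV vV hJ; have [uv uab vab] := jump_ends jw ut vt.
(* The new jump is also recorded at [v], by its reversal, whose interior is [n] up to order. *)
have [w' w'w ww'] := walk_rev (jump_path jw).
have [n' en'] : exists n', items w' = rcons n' (inr u).
  apply: walk_items_rcons w'w _; apply: contraTneq ww' => ->.
  by rewrite (jump_inner jw); apply/negP => /perm_size; rewrite /= size_rcons.
have nn' : perm_eq n' n.
  apply: perm_occ => t; move/(occ_perm t): ww'.
  by rewrite (jump_inner jw) en' occ_cons [in RHS]occ_cons !occ_rcons; clear; lia.
have notV x : x \in jdom J -> (x != u) && (x != v).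
  move=> /(along_sub hJ) xV; rewrite -negb_or; apply: contraL xV.
  by case/orP=> /eqP->.
pose J' := Jumps
  (fun x => if x == u then v else if x == v then u else jmate J x)
  (fun x => if x == u then w else if x == v then w' else jwalk J x)
  (fun x => if x == u then n else if x == v then n' else jinner J x)
  (u |: (v |: jdom J)).
have vu : (v == u) = false by rewrite eq_sym (negPf uv).
have J'P (R : vertex H -> Prop) :
      R u -> R v -> {in jdom J, forall x, x != u -> x != v -> R x} ->
    {in jdom J', forall x, R x}.
  move=> Ru Rv Rx x; rewrite !inE => /or3P[/eqP->|/eqP->|xJ] //.
  by have /andP[] := notV _ xJ; apply: Rx.
have [e en sep] := jump_separates jw.
have sep' : separates (edge_set P) e v u.
  by case: sep => s suv hs; exists s; rewrite // eq_sym.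
have js := along_system hJ.
have cost0 := jump_cost0 jw.
exists J'; split.
- split.
  + split; apply: J'P => /=; rewrite ?eqxx ?vu ?eqxx //.
    * by rewrite !inE eqxx orbT.
    * by rewrite !inE eqxx.
    * move=> x xJ /negPf-> /negPf->; rewrite !inE.
      by rewrite (mate_in js) ?orbT.
    * move=> x xJ /negPf-> /negPf->.
      have /andP[/negPf-> /negPf->] := notV _ (mate_in js xJ).
      exact: (mateK js).
    * by move=> x xJ /negPf-> /negPf->; apply: (mate_neq js).
    * exact: jump_path jw.
    * by move=> x xJ /negPf-> /negPf->; apply: (jump_walk js).
    * exact: jump_inner jw.
    * by move=> x xJ /negPf-> /negPf->; apply: (jump_items js).
    * by rewrite perm_sym.
    * move=> x xJ /negPf-> /negPf->.
      have /andP[/negPf-> /negPf->] := notV _ (mate_in js xJ).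
      exact: (inner_mate js).
    * apply/eqP; rewrite -leqn0 leqNgt -has_count; apply/hasPn => e'.
      rewrite negbK -mem_items_edge en' mem_rcons in_cons (perm_mem nn') /=.
      move=> e'n; apply: (cost_eq0 cost0).
      by rewrite -mem_items_edge (jump_inner jw) mem_rcons in_cons e'n orbT.
    * by move=> x xJ /negPf-> /negPf->; apply: (jump_cost js).
    * by exists e.
    * by exists e; rewrite // (perm_mem nn').
    * by move=> x xJ /negPf-> /negPf->; apply: (jump_sep js).
  + by apply: J'P => // x xJ _ _; apply: (along_touched hJ).
  + by apply: J'P => // x xJ _ _; apply: (along_ends hJ).
  + apply: J'P => [||x xJ _ _]; rewrite !inE ?eqxx ?orbT //.
    by rewrite (along_sub hJ) ?orbT.
  + move=> t; rewrite big_setU1 /=; last first.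
      by rewrite !inE negb_or uv; apply/negP => /notV; rewrite eqxx.
    rewrite big_setU1 /=; last by apply/negP => /notV; rewrite eqxx andbF.
    rewrite eqxx vu eqxx (occ_perm t nn') occ_cat_items (jump_inner jw) occ_rcons.
    rewrite (eq_bigr (fun x => occ t (jinner J x))); last first.
      by move=> x /notV /andP[/negPf-> /negPf->].
    by move: (along_load hJ t); clear; lia.
  + apply: J'P => /= [t|t|x xJ /negPf-> /negPf->]; rewrite ?eqxx ?vu ?eqxx.
    * exact: (jump_unused jw).
    * by rewrite (perm_mem nn'); apply: (jump_unused jw).
    * exact: (along_unused hJ).
  + apply: J'P => /= [||x xJ /negPf-> /negPf->]; rewrite ?eqxx ?vu ?eqxx.
    * exact: (jump_avoids_a jw).
    * by rewrite (perm_mem nn'); apply: (jump_avoids_a jw).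
    * exact: (along_a hJ).
- move=> e' [x xJ e'x]; exists x; first by rewrite !inE xJ !orbT.
  by have /andP[/negPf xu /negPf xv] := notV _ xJ; rewrite /= xu xv.
- by move=> e' e'n; exists u; rewrite /= ?eqxx // !inE eqxx.
Qed.

(** A used edge beyond the first one would start at a touched vertex, which can only be [v], but [v]
    occurs on [w] just once, at the end. The first edge starts at [u] and needs its own
    hypothesis. *)
Lemma first_segment_is_jump X w Y u v e z w1 :
  P = X ++ w ++ Y -> is_walk a X u -> is_walk u w v -> w = (e, z) :: w1 ->
  ~~ used (inl e) -> {in touched, forall x, inr x \in items w -> x = v} ->
  exists n, is_jump X w Y u v n.
Proof.
move=> PE Xw ww we ue first_v.
have [|n wn] := walk_items_rcons ww; first by rewrite we.
have wu : uniq (items w).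
  apply: uniq_occ => t; apply: leq_trans (occ_uniq t P_items_uniq).
  by rewrite PE !occ_cat_items addnCA leq_addr.
have vn : inr v \notin n by move: wu; rewrite wn rcons_uniq => /andP[].
have nv x : x \in touched -> inr x \notin n.
  move=> xt; apply/negP => xn; have := first_v _ xt; rewrite wn mem_rcons in_cons xn orbT.
  by move=> /(_ isT) xv; rewrite -xv xn in vn.
exists n; split=> //; last by apply: nv; rewrite inE eqxx.
case=> [e'|x] tn; last first.
  by apply: contraL tn => xu; apply: nv; rewrite inE xu orbT.
have [q [s [r wq]]] : exists q s r, w = q ++ (e', s) :: r.
  by apply: edge_split; rewrite wn mem_rcons in_cons tn orbT.
have [y qw yw] : exists2 y, is_walk u q y & is_walk y ((e', s) :: r) v.
  by apply: walk_catE; rewrite -wq.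
case: q wq qw => [|q0 q] wq qw.
  by move: wq; rewrite we => -[<- _ _].
apply/negP => ue'; have /andP[e'ys _] := yw.
have [n1 qn1] := walk_items_rcons qw isT; have [n2 rn2] := walk_items_rcons yw isT.
have yv : y = v.
  apply: first_v; first exact: used_ends ue' e'ys.
  by rewrite wq items_cat mem_cat qn1 mem_rcons mem_head.
move: wu; rewrite wq items_cat cat_uniq qn1 rn2 => /and3P[_ /hasPn/(_ (inr v))].
by rewrite !mem_rcons !mem_head yv mem_head => /(_ isT).
Qed.

(** The invariant is that only the class [J1] may have a jump end at the current vertex [u]. A new
    jump from [u] to [v] joins the class of the remainder that is free at [v], and then the two
    classes swap roles. *)
Lemma split_jumps (i0 : I) p X u : P = X ++ p -> is_walk a X u -> is_walk u p b ->
  u \in touched -> exists J1 J2,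
    [/\ jumps_along (u :: [seq s.2 | s <- p]) p J1, jumps_along [seq s.2 | s <- p] p J2 &
        forall e, inl e \in items p -> [\/ used (inl e), crossed J1 e | crossed J2 e]].
Proof.
have [m] := ubnP (size p); elim: m => // m IHm in p X u *.
case: p => [|[e z] p] pm PE Xw uw ut.
  have [J1 hJ1 _] := jumps_along_nil [:: u] [::].
  have [J2 hJ2 _] := jumps_along_nil [::] [::].
  by exists J1, J2; split.
have [Qw _ _ _] := Ql; have /andP[euz zw] := uw.
case: (boolP (used (inl e))) => ue.
  have zt : z \in touched by apply: used_ends ue _; rewrite joinsC; exact: euz.
  have [||J1 [J2 [h1 h2 cov]]] := IHm p (rcons X (e, z)) z pm _ _ zw zt.
  - by rewrite cat_rcons.
  - by rewrite -cats1; apply: walk_cat Xw _; rewrite /= euz eqxx.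
  exists J1, J2; split.
  - apply: jumps_along_widen h1 => [v|t].
      by rewrite [in X in _ -> X]in_cons => ->; rewrite orbT.
    by rewrite -cat1s occ_cat_items leq_addl.
  - apply: jumps_along_widen h2 => [v|t].
      by rewrite [in X in _ -> X]in_cons => ->; rewrite orbT.
    by rewrite -cat1s occ_cat_items leq_addl.
  - move=> e'; rewrite !in_cons /= => /orP[/eqP[->]|/cov//].
    by constructor 1.
have [|w [r [v [[wr uwv vr vt vw] first_v]]]] := walk_first (D := touched) uw.
  exists b; last by have [n ->] := walk_items_rcons uw isT; rewrite mem_rcons mem_head.
  rewrite inE; apply/orP; right; apply/usedP; exists i0.
  exact: walk_end_mem (Qw i0) ab.
have [w1 we] : exists w1, w = (e, z) :: w1.
  by case: (w) wr vw => // s w1 [<- _] _; exists w1.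
have PE' : P = X ++ w ++ r by rewrite PE wr.
have [n jw] := first_segment_is_jump PE' Xw uwv we ue first_v.
have [|||J1 [J2 [h1 h2 cov]]] := IHm r (X ++ w) v _ _ _ vr vt.
- move: pm; rewrite wr we /= size_cat; clear; lia.
- by rewrite -catA.
- exact: walk_cat Xw uwv.
have ur : u \notin [seq s.2 | s <- r].
  have := jump_fresh jw (walk_end_in Xw); rewrite map_cat mem_cat negb_or.
  by case/andP.
have vr' : v \notin [seq s.2 | s <- r].
  move: Pu; rewrite PE' !map_cat -cat_cons catA cat_uniq => /and3P[_ /hasPn dis _].
  apply/negP => /dis; rewrite mem_cat; have := jump_end jw.
  by move=> ->; rewrite orbT.
have [J1' [h1' covJ covn]] := jumps_along_add jw ut vt ur vr' h2.
rewrite wr; exists J1', J1; split.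
- apply: jumps_along_widen h1' => // x; rewrite !in_cons map_cat mem_cat.
  by case/or3P=> [/eqP->|/eqP->|->]; rewrite ?eqxx ?(jump_end jw) ?orbT.
- apply: jumps_along_widen h1 => [x|t].
    by rewrite !in_cons map_cat mem_cat => /orP[/eqP->|->]; rewrite ?(jump_end jw) ?orbT.
  by rewrite occ_cat_items leq_addl.
- move=> e'; rewrite items_cat mem_cat (jump_inner jw) mem_rcons in_cons /=.
  case/orP=> [/covn|/cov[?|?|?]]; first by constructor 2.
  + by constructor 1.
  + by constructor 3.
  + by constructor 2; apply: covJ.
Qed.

(** * From a class of jumps to cycles through [a] and [b] *)

Lemma load_le2 V J t : jumps_along V P J -> t != inr b ->
  load (jinner J) (jdom J) Q t <= 2.
Proof.
move=> hJ tb; have [_ _ Q1 _] := Ql; rewrite /load.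
case: (boolP (used t)) => ut.
  rewrite [X in _ + X]big1 ?addn0 => [|u uJ].
    by rewrite -[leqRHS]muln1 leq_pmul2l ?Q1.
  apply: occ_eq0.
  by apply: contraL ut; apply: (along_unused hJ).
rewrite big1 => [|l _]; last first.
  by apply: occ_eq0; apply: contra ut => tl; apply/usedP; exists l.
apply: leq_trans (along_load hJ t) _.
by rewrite -[leqRHS]muln1 leq_pmul2l // occ_uniq // P_items_uniq.
Qed.

Lemma load_start V J : jumps_along V P J -> load (jinner J) (jdom J) Q (inr a) = 0.
Proof.
move=> hJ; have [_ _ _ Qa] := Ql; rewrite /load !big1 // => [u uJ|l _].
  by apply: occ_eq0; apply: (along_a hJ).
exact: occ_eq0.
Qed.

(** A competitor within the load is again a linkage: load at most 2 gives disjointness, and load 0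
    at [a] keeps it off [a]. So minimality among linkages yields [cheapest]. *)
Lemma jumps_hole_routes V J : jumps_along V P J -> 1 < #|I| ->
  exists R, hole_routes b (jinner J) (jdom J) (fun=> a) Q R.
Proof.
move=> hJ I1; have [Qw Qb Q1 Qa] := Ql.
have used_b (l : I) : used (inr b).
  by apply/usedP; exists l; apply: walk_end_mem (Qw l) ab.
have [i0 _] : exists i0 : I, true by case/card_gt1P: I1 => i [_ [_ _ _]]; exists i.
apply: (hole_routes_exist I1 (along_system hJ)).
- split=> // [t tb|u uJ|u uJ|u uJ].
  + exact: load_le2 hJ tb.
  + by apply: contraL (used_b i0); apply: (along_unused hJ).
  + by have := along_ends hJ uJ; rewrite in_set2 negb_or => /andP[].
  + have := along_ends hJ uJ; rewrite in_set2 negb_or => /andP[/negPf ua _].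
    by have := along_touched hJ uJ; rewrite inE ua => /usedP.
- move=> p' p'w p'b p't; apply: Qmin; split=> // [t tb|l].
    by rewrite -(leq_pmul2l (m := 2)) //; apply: leq_trans (p't t tb) (load_le2 hJ tb).
  have := p't (inr a) ab.
  rewrite (load_start hJ) leqn0 muln_eq0 /= (bigD1 l) //= addn_eq0.
  by case/andP=> /eqP h _; apply: notin_occ.
Qed.

(** One path is followed by the reversal of the other, which trades [b] for [a], so each of the two
    is reached exactly once. *)
Lemma cycle_of_paths p q : is_walk a p b -> is_walk a q b ->
  inr a \notin items p -> inr a \notin items q ->
  occ (inr b) (items p) <= 1 -> occ (inr b) (items q) <= 1 ->
  (forall t, t != inr b -> occ t (items p) + occ t (items q) <= 1) ->
  exists C, [/\ is_cycle a C, a \in vertex_set a C, b \in vertex_set a C &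
    forall e, inl e \in items p \/ inl e \in items q -> e \in edge_set C].
Proof.
move=> pw qw ap aq bp bq pq.
have [q' q'w qq'] := walk_rev qw.
have q'E t : occ t [:: inr a] + occ t (items q) = occ t [:: inr b] + occ t (items q').
  by have := occ_perm t qq'; rewrite occ_cons [in RHS]occ_cons.
have bpi := walk_end_mem pw ab.
exists (p ++ q'); split.
- have : uniq (items (p ++ q')).
    apply: uniq_occ => -[e|v]; rewrite occ_cat_items.
      have := q'E (inl e); rewrite !occ1 => /= /addnI <-; exact: pq.
    have := q'E (inr v); rewrite !occ1_vertex.
    have [-> | vb] := eqVneq v b.
      by rewrite eq_sym (negPf ab); move: bp bq; clear; lia.
    have [-> | va] := eqVneq v a; last by move=> /addnI <-; apply: pq.
    have p0 : occ (inr a) (items p) = 0 by apply: occ_eq0.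
    have q0 : occ (inr a) (items q) = 0 by apply: occ_eq0.
    by rewrite p0 q0; clear; lia.
  rewrite items_uniq => /andP[ue uv]; apply/and4P; split=> //.
    exact: walk_cat pw q'w.
  by rewrite size_cat; case: (p) bpi.
- by rewrite inE mem_head.
- by rewrite inE in_cons map_cat mem_cat -mem_items_vertex bpi orbT.
- move=> e; rewrite inE map_cat mem_cat -!mem_items_edge => -[->//|eq].
  apply/orP; right; have := perm_mem qq' (inl e); rewrite !in_cons /= => <-.
  by rewrite eq.
Qed.

Lemma cycle_of_routes V J R h : #|I| = 3 -> jumps_along V P J ->
  hole_routes b (jinner J) (jdom J) (fun=> a) Q R ->
  exists C, [/\ is_cycle a C, a \in vertex_set a C, b \in vertex_set a C &
    forall l e, l != h -> inl e \in items (R h l) -> e \in edge_set C].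
Proof.
move=> I3 hJ hR; have : #|[set~ h]| == 2 by rewrite cardsC1 I3.
case/cards2P=> l1 [l2 [l12 hE]].
have lh l : (l != h) = (l == l1) || (l == l2) by rewrite -in_set2 -hE !inE.
have l1h : l1 != h by rewrite lh eqxx.
have l2h : l2 != h by rewrite lh eqxx orbT.
have sum t : \sum_(l | l != h) occ t (items (R h l)) =
    occ t (items (R h l1)) + occ t (items (R h l2)).
  rewrite (bigD1 l1) //= (bigD1 l2) /=; last by rewrite l2h eq_sym.
  rewrite big1 ?addn0 // => l /andP[/andP[]]; rewrite lh.
  by case/orP=> ->.
have bound t : t != inr b -> 2 * (occ t (items (R h l1)) + occ t (items (R h l2)))
    <= load (jinner J) (jdom J) Q t.
  by move=> tb; rewrite -sum; apply: (route_load hR).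
have [|||||||C [Cc Ca Cb CE]] := @cycle_of_paths (R h l1) (R h l2).
- exact: (route_walk hR).
- exact: (route_walk hR).
- have := bound (inr a) ab; rewrite (load_start hJ) leqn0 muln_eq0 /= addn_eq0.
  by case/andP=> /eqP h0 _; apply: notin_occ.
- have := bound (inr a) ab; rewrite (load_start hJ) leqn0 muln_eq0 /= addn_eq0.
  by case/andP=> _ /eqP h0; apply: notin_occ.
- exact: (route_end hR).
- exact: (route_end hR).
- move=> t tb; rewrite -(leq_pmul2l (m := 2)) //.
  exact: leq_trans (bound t tb) (load_le2 hJ tb).
exists C; split=> // l e; rewrite lh => /orP[]/eqP-> el; apply: CE; by [left | right].
Qed.

Lemma six_cycles : #|I| = 3 -> exists C : bool * I -> seq (edge H * vertex H),
  (forall k, [/\ is_cycle a (C k), a \in vertex_set a (C k) & b \in vertex_set a (C k)])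
  /\ edge_set P \subset \bigcup_k edge_set (C k).
Proof.
move=> I3; have I1 : 1 < #|I| by rewrite I3.
have [i0 _] : exists i0 : I, true by case/card_gt1P: (I1) => i [_ [_ _ _]]; exists i.
have at_ : a \in touched by rewrite inE eqxx.
have [J1 [J2 [h1 h2 cov]]] := split_jumps i0 (erefl : P = [::] ++ P) (eqxx a) Pw at_.
have [R1 hR1] := jumps_hole_routes h1 I1; have [R2 hR2] := jumps_hole_routes h2 I1.
have /fin_all_exists[C1 hC1] h := cycle_of_routes h I3 h1 hR1.
have /fin_all_exists[C2 hC2] h := cycle_of_routes h I3 h2 hR2.
(* A cycle is indexed by its class of jumps and its initial hole. *)
exists (fun k => if k.1 then C1 k.2 else C2 k.2); split.
  by case=> [[] h] /=; [case: (hC1 h) | case: (hC2 h)].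
apply/subsetP => e; rewrite inE -mem_items_edge => eP; apply/bigcupP.
have route1 : covered (jinner J1) (jdom J1) Q e -> exists2 k : bool * I, true &
    e \in edge_set (if k.1 then C1 k.2 else C2 k.2).
  case/(route_cover hR1) => h [l [lh el]]; exists (true, h) => //=.
  by have [_ _ _] := hC1 h; apply; [exact: lh | exact: el].
have route2 : covered (jinner J2) (jdom J2) Q e -> exists2 k : bool * I, true &
    e \in edge_set (if k.1 then C1 k.2 else C2 k.2).
  case/(route_cover hR2) => h [l [lh el]]; exists (false, h) => //=.
  by have [_ _ _] := hC2 h; apply; [exact: lh | exact: el].
(* Either class covers all edges of the linkage; the first one serves for the used edges. *)
case: (cov e eP) => [/usedP eQ|eJ|eJ].
- by apply: route1; left.
- by apply: route1; right.
- by apply: route2; right.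
Qed.

End Jumps.

(** * Linkages and the six cycles *)

Section MinimumLinkage.

Variables (H : multigraph) (a b : vertex H).
Implicit Types (e : edge H) (Q : seq (edge H * vertex H)).

(** A path meets [a] only at its start and [b] only at its end, so an edge of it with no other ends
    is the whole path. *)
Lemma path_through_both_ends e u v Q : is_path a b Q -> inl e \in items Q ->
  joins e u v -> u \in [set a; b] -> v \in [set a; b] -> a != b -> Q = [:: (e, b)].
Proof.
move=> /andP[Qw Qu] eQ euv uab vab ab.
have eab x : x \in ends e -> x \in [set a; b].
  by move/eqP: euv => ->; rewrite in_set2 => /orP[]/eqP->.
have [q [y [r QE]]] := edge_split eQ; move: Qw Qu; rewrite QE => /walk_catE[x qx].
case/andP=> exy yr Qu; have /eqP ends_e := exy.
have ry := walk_end_in yr; have xq := walk_end_in qx.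
have {}Qu : uniq (a :: [seq s.2 | s <- q] ++ y :: [seq s.2 | s <- r]).
  by move: Qu; rewrite map_cat.
have xa : x = a.
  have : x \in [set a; b] by apply: eab; rewrite ends_e in_set2 eqxx.
  rewrite in_set2 => /orP[]/eqP // xb; move: Qu; rewrite -cat_cons cat_uniq.
  by case/and3P=> _ /hasPn/(_ _ ry); rewrite -xb xq.
have q0 : q = [::].
  apply/eqP; apply: contraT => /(walk_items_rcons qx)[n qn].
  have : a \in [seq s.2 | s <- q].
    by rewrite -mem_items_vertex qn xa mem_rcons mem_head.
  by case/andP: Qu; rewrite mem_cat negb_or => /andP[/negPf->].
have yb : y = b.
  have : y \in [set a; b] by apply: eab; rewrite ends_e in_set2 eqxx orbT.
  rewrite in_set2 => /orP[]/eqP // ya; case/andP: Qu.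
  by rewrite mem_cat ya mem_head orbT.
have r0 : r = [::].
  apply/eqP; apply: contraT => /(walk_items_rcons yr)[n rn].
  have : b \in [seq s.2 | s <- r].
    by rewrite -mem_items_vertex rn mem_rcons mem_head.
  by move: Qu; rewrite yb -cat_cons cat_uniq => /and3P[_ _ /andP[/negPf->]].
by rewrite q0 r0 yb.
Qed.

(** Internal disjointness does not mention edges. A shared edge has both ends in common, hence in
    [[set a; b]], so both paths consist of that edge alone and are not distinct. *)
Lemma disjoint_paths_occ Q Q' t : a != b -> is_path a b Q -> is_path a b Q' ->
  internally_disjoint a b Q Q' -> t != inr b -> t \in items Q -> t \notin items Q'.
Proof.
move=> ab pQ pQ' /andP[QQ' /eqP dis] tb tQ; apply/negP => tQ'.
have both v : v \in a :: [seq s.2 | s <- Q] -> v \in a :: [seq s.2 | s <- Q'] ->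
    v \in [set a; b].
  by move=> vQ vQ'; rewrite -dis inE !inE -!(in_cons a) vQ.
have [Qw Qu] := andP pQ; have [Q'w Q'u] := andP pQ'.
case: t tb tQ tQ' => [e _ eQ eQ'|v vb vQ vQ'].
  have [q [v [r QE]]] := edge_split eQ.
  move: (Qw); rewrite QE => /walk_catE[u _ /andP[euv _]].
  have evu : joins e v u by rewrite joinsC.
  have uab := both u (walk_edge_end Qw eQ euv) (walk_edge_end Q'w eQ' euv).
  have vab := both v (walk_edge_end Qw eQ evu) (walk_edge_end Q'w eQ' evu).
  case/eqP: QQ'; rewrite (path_through_both_ends pQ eQ euv) //.
  by rewrite (path_through_both_ends pQ' eQ' euv).
have : v \in [set a; b].
  by apply: both; rewrite in_cons -mem_items_vertex ?vQ ?vQ' orbT.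
rewrite in_set2 => /orP[]/eqP ve; last by rewrite ve eqxx in vb.
by move: Qu; rewrite /= -ve -mem_items_vertex vQ.
Qed.

Lemma linkage_of_paths (Q : 'I_3 -> seq (edge H * vertex H)) : a != b ->
  (forall i, is_path a b (Q i)) ->
  (forall i j, i != j -> internally_disjoint a b (Q i) (Q j)) -> linkage a b Q.
Proof.
move=> ab pQ dis; have wQ i : is_walk a (Q i) b by case/andP: (pQ i).
have uQ i : uniq (items (Q i)).
  by case/andP: (pQ i) => *; apply: path_items_uniq (wQ i) _.
split=> // [i|t tb|i].
- exact: occ_uniq.
- have [/existsP[i ti]|none] := boolP [exists i, t \in items (Q i)].
    rewrite (bigD1 i) //= big1 ?addn0 ?occ_uniq // => j ji.
    apply: occ_eq0; apply: (disjoint_paths_occ ab (pQ i) (pQ j)) => //.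
    by apply: dis; rewrite eq_sym.
  rewrite big1 // => i _; apply: occ_eq0; apply: contra none => ti.
  by apply/existsP; exists i.
- by case/andP: (pQ i) => _ /andP[+ _]; rewrite mem_items_vertex.
Qed.

(** Descent on the cost; excluded middle decides whether a cheaper linkage exists. *)
Lemma minimum_linkage (I : finType) (F : {set edge H})
    (Q : I -> seq (edge H * vertex H)) :
  linkage a b Q -> exists2 Q0 : I -> seq (edge H * vertex H), linkage a b Q0 &
    forall Q' : I -> seq (edge H * vertex H), linkage a b Q' ->
    \sum_l cost F (Q0 l) <= \sum_l cost F (Q' l).
Proof.
have [n] := ubnP (\sum_l cost F (Q l)); elim: n => // n IHn in Q * => Qn lQ.
have [[Q' [lQ' lt]]|none] := classic (exists Q' : I -> seq (edge H * vertex H),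
    linkage a b Q' /\ \sum_l cost F (Q' l) < \sum_l cost F (Q l)).
  by apply: (IHn Q') => //; apply: leq_trans lt _.
exists Q => // Q' lQ'; rewrite leqNgt; apply/negP => lt.
by apply: none; exists Q'.
Qed.

End MinimumLinkage.

(** * Averaging over the six cycles *)

Theorem theorem4p2 (H : multigraph) (a b : vertex H) :
  a != b ->
  (exists Q1 Q2 Q3 : seq (edge H * vertex H),
      [/\ is_path a b Q1, is_path a b Q2 & is_path a b Q3] /\
      [/\ internally_disjoint a b Q1 Q2, internally_disjoint a b Q1 Q3
        & internally_disjoint a b Q2 Q3]) ->
  forall P : seq (edge H * vertex H), is_path a b P ->
  exists (x : vertex H) (C : seq (edge H * vertex H)),
    [/\ is_cycle x C, a \in vertex_set x C, b \in vertex_set x C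
      & ((size P)%:R / 6%:R <= #|edge_set C :&: edge_set P|%:R :> rat)%R].
Proof.
move=> ab [Q1 [Q2 [Q3 [[p1 p2 p3] [d12 d13 d23]]]]] P pP.
have disC Q Q' : internally_disjoint a b Q Q' -> internally_disjoint a b Q' Q.
  by rewrite /internally_disjoint eq_sym setIC.
pose Q (i : 'I_3) := nth Q1 [:: Q1; Q2; Q3] i.
have lQ : linkage a b Q.
  apply: linkage_of_paths => // [[[|[|[|]]] //]|].
  by move=> [[|[|[|]]] //= ?] [[|[|[|]]] //= ?] _; rewrite /Q //=; apply: disC.
have [Pw Pu] := andP pP.
have [Q0 lQ0 minQ0] := minimum_linkage (edge_set P) lQ.
have [C [hC cov]] := six_cycles ab Pw Pu lQ0 minQ0 (card_ord 3).
have sizeP : size P = #|edge_set P|.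
  have := path_items_uniq Pw Pu; rewrite items_uniq => /andP[ue _].
  by rewrite cardsE (card_uniqP ue) size_map.
have : exists k, size P <= 6 * #|edge_set (C k) :&: edge_set P|.
  (* Otherwise each of the six cycles shares less than a sixth of the edges of [P], and together
     they cannot cover [P]. *)
  apply/existsP; apply: contraT; rewrite negb_exists => /forallP small.
  have P0 : 0 < #|edge_set P|.
    by have := small (true, ord0); rewrite -ltnNge sizeP; apply: leq_trans.
  have : #|edge_set P| <= \sum_k #|edge_set (C k) :&: edge_set P|.
    rewrite -{1}(setIidPr cov) big_distrl /=.
    apply: (big_ind2 (fun (A : {set edge H}) m => #|A| <= m)) => [|A m B m' Am Bm'|//].
      by rewrite cards0.
    exact: leq_trans (leq_of_leqif (leq_card_setU A B)) (leq_add Am Bm').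
  rewrite -(leq_pmul2l (m := 6)) // big_distrr leqNgt => /negP[].
  (* Each summand is an integer below [#|edge_set P|], hence at most its predecessor, which [P0]
     makes strictly smaller. *)
  apply: (@leq_ltn_trans (\sum_(k : bool * 'I_3) #|edge_set P|.-1)).
    by apply: leq_sum => k _; rewrite -ltnS prednK // -sizeP ltnNge small.
  by rewrite sum_nat_const card_prod card_bool card_ord ltn_pmul2l // prednK.
case=> k hk; exists a, (C k); have [? ? ?] := hC k; split=> //.
rewrite Num.Theory.ler_pdivrMr ?Num.Theory.ltr0n //.
by rewrite -GRing.Theory.natrM Num.Theory.ler_nat mulnC.
Qed.
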